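(* Let $A$ be an idiom, $j\in N(A)$, and let $[a,b]$ be an interval of $A$ with $[a,b]\notin\mathscr{F}_j$ such that $[a,b]$ satisfies $C_1$. If $j$ is stable, then $j(a)\wedge b$ has a complement in $[a,b]$.
   Context: An idiom is a complete lattice $A$ (least element $0$, greatest element $1$) that is modular, i.e. $a\le b$ implies $(a\vee c)\wedge b=a\vee(c\wedge b)$, and upper continuous, i.e. $a\wedge\bigvee X=\bigvee\{a\wedge x\mid x\in X\}$ for all $a\in A$ and all directed $X\subseteq A$. For $a\le b$ in $A$, $[a,b]=\{x\in A\mid a\le x\le b\}$ is an interval (itself an idiom). An element $x\in[a,b]$ is essential in $[a,b]$ if for every $y\in[a,b]$, $x\wedge y=a$ implies $y=a$. A nucleus on $A$ is a monotone map $j:A\to A$ with $a\le j(a)$, $j(a\wedge b)\ge j(a)\wedge j(b)$ and $j\circ j=j$. $N(A)$ is the set of nuclei ordered pointwise. For each interval $[a,b]$ there is a largest nucleus $\chi(a,b)$ on $A$ such that $\chi(a,b)(a)\wedge b=a$. For a nucleus $j$: $\mathscr{F}_j=\{[a,b]\mid j\le\chi(a,b)\}$ and $\mathscr{D}_j=\{[a,b]\mid b\le j(a)\}$. A nucleus $j$ is stable if whenever $[a,b]\in\mathscr{D}_j$ and $a\le b\le c$ with $b$ essential in $[a,c]$, then $[a,c]\in\mathscr{D}_j$. An idiom $L$ with least element $0_L$ satisfies condition $C_1$ if for every $x\in L$ there is an element $c\in L$ that has a complement in $L$ and such that $x$ is essential in $[0_L,c]$. ''$[a,b]$ satisfies $C_1$''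 means this for $L=[a,b]$. *)

(* Defs.v *)
From HB Require Import structures.
From mathcomp Require Import all_boot all_order.
From mathcomp Require Import boolp classical_sets.

Set Implicit Arguments.
Unset Strict Implicit.
Unset Printing Implicit Defensive.

Import Order.TTheory.
Local Open Scope order_scope.

Definition directed_set d (T : porderType d) (X : set T) : Prop :=
  (exists x, X x) /\
  forall x y, X x -> X y -> exists z, [/\ X z, x <= z & y <= z].

(* The value for the empty set is the default argument of supremum, which has
   to be \bot for this to be the join in a complete lattice. *)
Definition bigjoin d (T : tbLatticeType d) (X : set T) : T :=
  supremum (\bot : T) X.

HB.mixin Record TBLattice_isIdiom d A of Order.TBLattice d A := {
  supremums_ex : forall X : set A, exists s, supremums X s ;
  idiom_modular : forall a b c : A, a <= b ->
    (a `|` c) `&` b = a `|` (c `&` b) ;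
  idiom_upper_continuous : forall (a : A) (X : set A), directed_set X ->
    a `&` bigjoin X = bigjoin (image X (fun x => a `&` x))
}.

#[short(type="idiomType")]
HB.structure Definition Idiom d :=
  { A of TBLattice_isIdiom d A & Order.TBLattice d A }.

Section Idiom.
Context {d : Order.disp_t} {A : idiomType d}.
Implicit Types (a b c x y : A) (j k : A -> A).

(* An interval [a, b] is represented by its end points a <= b; it is a
   sublattice of A with least element a and greatest element b. *)

Definition essential_in a b x : Prop :=
  a <= x <= b /\ forall y, a <= y <= b -> x `&` y = a -> y = a.

Definition complement_in a b x y : Prop :=
  [/\ a <= x <= b, a <= y <= b, x `&` y = a & x `|` y = b].

Definition complemented_in a b x : Prop := exists y, complement_in a b x y.

(* For the idiom L = [a, b], an interval [0_L, c] of L is [a, c]. *)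
Definition C1 a b : Prop :=
  forall x, a <= x <= b ->
  exists c, [/\ a <= c <= b, complemented_in a b c & essential_in a c x].

Definition nucleus j : Prop :=
  [/\ {homo j : x y / x <= y},
      forall x, x <= j x,
      forall x y, j x `&` j y <= j (x `&` y) &
      forall x, j (j x) = j x].

(* Maps A -> A carry the pointwise order. *)
Definition largest_nucleus (P : (A -> A) -> Prop) k : Prop :=
  [/\ nucleus k, P k & forall j, nucleus j -> P j -> j <= k].

(* The default value idfun is irrelevant when a <= b, see chiP. *)
Definition chi a b : A -> A :=
  xget (idfun : A -> A) (largest_nucleus (fun j => j a `&` b = a)).

Definition F_ j a b : Prop := a <= b /\ j <= chi a b.

Definition D_ j a b : Prop := a <= b /\ b <= j a.

Definition stable j : Prop :=
  forall a b c, D_ j a b -> a <= b <= c -> essential_in a c b -> D_ j a c.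

Lemma bigjoin_supremums (X : set A) : supremums X (bigjoin X).
Proof.
rewrite /bigjoin /supremum; case: ifPn => [/eqP ->|_].
  by split=> [x []|x _]; exact: le0x.
by apply: xgetPex; exact: supremums_ex.
Qed.

Lemma bigjoin_ub (X : set A) x : X x -> x <= bigjoin X.
Proof. by case: (bigjoin_supremums X) => ub _; exact: ub. Qed.

Lemma bigjoin_le (X : set A) y : (forall x, X x -> x <= y) -> bigjoin X <= y.
Proof. by case: (bigjoin_supremums X) => _ lb; exact: lb. Qed.

(* The largest nucleus is the pointwise join of all prenuclei (nuclei without
   idempotency) f with f a `&` b = a, a family closed under composition. *)
Lemma chi_ex a b : a <= b ->
  exists k, largest_nucleus (fun j => j a `&` b = a) k.
Proof.
move=> leab.
pose pre (f : A -> A) := [/\ {homo f : x y / x <= y}, forall x, x <= f x,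
  forall x y, f x `&` f y <= f (x `&` y) & f a `&` b = a].
pose V x : set A := [set y | exists2 f, pre f & y = f x]%classic.
pose k x := bigjoin (V x).
have pre_id : pre idfun by split=> //; apply/meet_idPl.
have pre_comp f g : pre f -> pre g -> pre (f \o g).
  move=> [f1 f2 f3 f4] [g1 g2 g3 g4]; split=> /=.
  - by move=> x y xy; apply/f1/g1.
  - by move=> x; exact: le_trans (g2 x) (f2 _).
  - by move=> x y; apply: le_trans (f3 _ _) (f1 _ _ (g3 _ _)).
  - apply/le_anti/andP; split; last first.
      by rewrite lexI leab (le_trans (g2 a) (f2 _)).
    rewrite -[X in _ <= X]f4 lexI leIr andbT.
    by rewrite -[X in _ <= f X]g4; apply: le_trans (f3 _ _); exact: leI2.
have Vdir x : directed_set (V x).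
  split; first by exists x, idfun.
  move=> _ _ [f pf ->] [g pg ->]; exists (f (g x)); split.
  - by exists (f \o g) => //; exact: pre_comp.
  - by case: pf pg => f1 _ _ _ [_ g2 _ _]; exact: f1.
  - by case: pf => _ f2 _ _; exact: f2.
have kub f x : pre f -> f x <= k x by move=> pf; apply: bigjoin_ub; exists f.
have kpre : pre k.
  split.
  - move=> x y xy; apply: bigjoin_le => _ [f pf ->].
    by apply: le_trans (kub f y pf); case: pf => f1 _ _ _; exact: f1.
  - by move=> x; exact: (kub idfun).
  - move=> x y; rewrite idiom_upper_continuous //.
    apply: bigjoin_le => _ [_ [g pg ->] <-].
    rewrite meetC idiom_upper_continuous //.
    apply: bigjoin_le => _ [_ [f pf ->] <-].
    have pfg := pre_comp _ _ pf pg.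
    apply: le_trans (kub _ _ pfg).
    have [_ _ fg3 _] := pfg; apply: le_trans (fg3 _ _).
    rewrite meetC; apply: leI2.
      by case: pf pg => f1 _ _ _ [_ g2 _ _]; exact: f1.
    by case: pf => _ f2 _ _; exact: f2.
  - apply/le_anti/andP; split; last by rewrite lexI leab (kub idfun).
    rewrite meetC idiom_upper_continuous //.
    by apply: bigjoin_le => _ [_ [f [_ _ _ f4] ->] <-]; rewrite meetC f4.
have [k1 k2 k3 k4] := kpre.
exists k; split=> //.
  split=> // x; apply/le_anti/andP; split; last exact: k2.
  by apply: (kub (k \o k)); exact: pre_comp.
by move=> j [j1 j2 j3 _] ja; apply/lefP => x; exact: kub.
Qed.

Lemma chiP a b : a <= b ->
  largest_nucleus (fun j => j a `&` b = a) (chi a b).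
Proof. by move=> /chi_ex; exact: (xgetPex (idfun : A -> A)). Qed.

End Idiom.

(* Main.v *)
Require Import Defs.
From mathcomp Require Import all_boot all_order.

Import Order.TTheory.

Local Open Scope order_scope.

(** Let x be the meet of [j a] and [b]. [C1] makes x essential in [a, c] for some complemented c. As
    x lies below [j a], stability carries this bound over to c; but x is the largest element of
    [a, b] below [j a], so x = c. *)

Theorem proposition4p3 (d : Order.disp_t) (A : idiomType d) (j : A -> A)
    (a b : A) (hj : nucleus j) (hab : a <= b) (hF : ~ F_ j a b)
    (hC1 : C1 a b) (hstable : stable j) :
  complemented_in a b (j a `&` b).
Proof.
have [_ j_ext _ _] := hj.
have a_x : a <= j a `&` b by rewrite lexI j_ext hab.
have x_b : j a `&` b <= b := leIr _ _.
have [|c [/andP[_ c_b] c_compl ess]] := hC1 (j a `&` b).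
  by rewrite a_x x_b.
have x_c : j a `&` b <= c by case: ess => /andP[].
(* Stability forces c into j a, so the essential extension is trivial. *)
have [_ c_ja] : D_ j a c.
  apply: hstable ess; first by split=> //; exact: leIl.
  by rewrite a_x x_c.
(* The complement of [c], kept in [c_compl], then serves for the meet as well. *)
suff -> : j a `&` b = c by [].
by apply/le_anti; rewrite x_c lexI c_ja c_b.
Qed.
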